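(* Let $L$ be a language, all of whose function symbols are unary, equipped with a permutation group $\Gamma_L$ and let $\mathbf A$ be a finite $\Gamma_L$-structure. If $\mathbf A$ lies in an infinite orbit of the action of $\Gamma_L$ by relabelling, then there is no finite $\Gamma_L$-structure $\mathbf B$ which is an EPPA-witness for $\mathbf A$.
   Context: Structures. A language $L$ consists of relation symbols $R$ (of arity $a(R)\ge 1$) and function symbols $F$ (of arity $a(F)\ge 0$; $F$ is unary if $a(F)=1$). $L$ is equipped with a permutation group $\Gamma_L$ if $\Gamma_L$ is a group of permutations of $L$ mapping relation symbols to relation symbols and function symbols to function symbols and preserving arities. A $\Gamma_L$-structure $\mathbf A$ has a finite or countably infinite vertex set $A$ (possibly empty), a relation $R_{\mathbf A}\subseteq A^{a(R)}$ for each relation symbol $R\in L$, and a function $F_{\mathbf A}\colon A^{a(F)}\to\mathcal P(A)$ (the power set of $A$) for each function symbol $F\in L$. It is finite if $A$ is finite. Maps. An embedding $f\colon\mathbf A\to\mathbf B$ is a pair $f=(f_L,f_A)$ with $f_L\in\Gamma_L$ and $f_A\colon A\to B$ injective such that, for all $R,F\in L$ and all tuples $\bar x$, $\bar x\in R_{\mathbf A}$ if and only if $f_A(\bar x)\in f_L(R)_{\mathbf B}$, and $f_A(F_{\mathbf A}(\bar x))=f_L(F)_{\mathbf B}(f_A(\bar x))$. An isomorphism is an embedding with $f_A$ bijective; an automorphism is an isomorphism of a structure to itself. $\mathbf A$ is a substructure of $\mathbf B$ if $A\subseteq B$ and the pair ($\mathrm{id}_L$, inclusion) is an embedding (the structure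 with empty vertex set counts as a substructure when there are no nullary functions). For an embedding $f\colon\mathbf A\to\mathbf B$, $f(\mathbf A)$ is the substructure of $\mathbf B$ with vertex set $f_A(A)$. Relabelling. For $g\in\Gamma_L$, $g\mathbf A$ is the $\Gamma_L$-structure on the vertex set $A$ with $R_{g\mathbf A}=(g^{-1}(R))_{\mathbf A}$ and $F_{g\mathbf A}=(g^{-1}(F))_{\mathbf A}$; this defines the action of $\Gamma_L$ by relabelling. EPPA. A partial automorphism of $\mathbf A$ is an isomorphism $f$ between substructures of $\mathbf A$; its language part $f_L\in\Gamma_L$ is part of the data (so for instance $(g,\emptyset)$, $g\in\Gamma_L$, with empty vertex part, is a partial automorphism). An automorphism $\theta$ extends $f$ if $\theta$ has the same language part as $f$ and its vertex part extends that of $f$. A finite $\mathbf B$ is an EPPA-witness for a finite $\mathbf A$ if there is an embedding $\psi\colon\mathbf A\to\mathbf B$ such that every partial automorphism of $\psi(\mathbf A)$ extends to an automorphism of $\mathbf B$. *)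

(* Defs.v *)
From HB Require Import structures.
From mathcomp Require Import all_boot.
From mathcomp Require Import boolp classical_sets cardinality.

Set Implicit Arguments.
Unset Strict Implicit.
Unset Printing Implicit Defensive.

Local Open Scope classical_set_scope.

(* Symbols are sorted by kind and graded by arity, so that a map of symbols
   preserving kinds and arities is a family of maps indexed by the arity. *)
Record language := Language {
  relsym : nat -> Type;
  funsym : nat -> Type;
  rel_arity_gt0 : relsym 0 -> False }.

Definition unary_functions (L : language) : Prop :=
  forall n, funsym L n -> n = 1%N.

Record lang_perm (L : language) := LangPerm {
  prel : forall n, relsym L n -> relsym L n;
  prelV : forall n, relsym L n -> relsym L n;
  pfun : forall n, funsym L n -> funsym L n;
  pfunV : forall n, funsym L n -> funsym L n;
  prelK : forall n, cancel (@prel n) (@prelV n);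
  prelVK : forall n, cancel (@prelV n) (@prel n);
  pfunK : forall n, cancel (@pfun n) (@pfunV n);
  pfunVK : forall n, cancel (@pfunV n) (@pfun n) }.

Definition lperm1 (L : language) : lang_perm L :=
  @LangPerm L (fun _ => id) (fun _ => id) (fun _ => id) (fun _ => id)
    (fun _ => frefl _) (fun _ => frefl _) (fun _ => frefl _) (fun _ => frefl _).

Definition lpermV (L : language) (g : lang_perm L) : lang_perm L :=
  LangPerm (prelVK g) (prelK g) (pfunVK g) (pfunK g).

Definition lpermM (L : language) (g h : lang_perm L) : lang_perm L :=
  @LangPerm L
    (fun n => @prel L g n \o @prel L h n) (fun n => @prelV L h n \o @prelV L g n)
    (fun n => @pfun L g n \o @pfun L h n) (fun n => @pfunV L h n \o @pfunV L g n)
    (fun n => can_comp (@prelK L g n) (@prelK L h n))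
    (fun n => can_comp (@prelVK L h n) (@prelVK L g n))
    (fun n => can_comp (@pfunK L g n) (@pfunK L h n))
    (fun n => can_comp (@pfunVK L h n) (@pfunVK L g n)).

Record perm_group (L : language) := PermGroup {
  group_elt :> set (lang_perm L);
  group_elt1 : group_elt (lperm1 L);
  group_eltV : forall g, group_elt g -> group_elt (lpermV g);
  group_eltM : forall g h, group_elt g -> group_elt h -> group_elt (lpermM g h) }.

(* A countType is a finite (possibly empty) or countably infinite vertex set. *)
Record structure (L : language) (V : countType) := Structure {
  srel : forall n, relsym L n -> set (n.-tuple V);
  sfun : forall n, funsym L n -> n.-tuple V -> set V }.

Definition embedding (L : language) (G : perm_group L) (V W : countType)
    (A : structure L V) (B : structure L W)
    (g : lang_perm L) (f : V -> W) : Prop :=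
  [/\ group_elt G g, injective f,
      forall n (R : relsym L n) (x : n.-tuple V),
        srel A R x <-> srel B (prel g R) (map_tuple f x)
    & forall n (F : funsym L n) (x : n.-tuple V),
        f @` sfun A F x = sfun B (pfun g F) (map_tuple f x)].

Definition isomorphism (L : language) (G : perm_group L) (V W : countType)
    (A : structure L V) (B : structure L W)
    (g : lang_perm L) (f : V -> W) : Prop :=
  embedding G A B g f /\ bijective f.

Definition automorphism (L : language) (G : perm_group L) (V : countType)
    (A : structure L V) (g : lang_perm L) (f : V -> V) : Prop :=
  isomorphism G A A g f.

Definition substructure (L : language) (G : perm_group L) (V : countType)
    (S : set V) (A : structure L (set_type S)) (B : structure L V) : Prop :=
  embedding G A B (lperm1 L) val.

(* The trace of B on S: the substructure of B with vertex set S when there is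
   one, in particular when S is the range of an embedding into B. *)
Definition induced (L : language) (V : countType) (B : structure L V)
    (S : set V) : structure L (set_type S) :=
  Structure
    (fun n (R : relsym L n) => [set x | srel B R (map_tuple val x)])
    (fun n (F : funsym L n) x => [set y | sfun B F (map_tuple val x) (val y)]).

(* The vertex part of an isomorphism between substructures of A, with vertex
   sets S and T, is a map from the subtype S to the subtype T. *)
Definition partial_automorphism (L : language) (G : perm_group L)
    (V : countType) (A : structure L V) (S T : set V)
    (g : lang_perm L) (f : set_type S -> set_type T) : Prop :=
  exists (A1 : structure L (set_type S)) (A2 : structure L (set_type T)),
    [/\ substructure G A1 A, substructure G A2 A & isomorphism G A1 A2 g f].

Definition EPPA_witness (L : language) (G : perm_group L) (V W : finType)
    (A : structure L V) (B : structure L W) : Prop :=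
  exists (g : lang_perm L) (psi : V -> W),
    embedding G A B g psi /\
    forall (S T : set (set_type (range psi)))
           (h : lang_perm L) (f : set_type S -> set_type T),
      partial_automorphism G (induced B (range psi)) h f ->
      exists t : W -> W,
        automorphism G B h t /\
        forall x : set_type S, t (val (val x)) = val (val (f x)).

Definition relabel (L : language) (V : countType) (g : lang_perm L)
    (A : structure L V) : structure L V :=
  Structure (fun n (R : relsym L n) => srel A (prelV g R))
            (fun n (F : funsym L n) => sfun A (pfunV g F)).

Definition relabel_orbit (L : language) (G : perm_group L) (V : countType)
    (A : structure L V) : set (structure L V) :=
  [set relabel g A | g in G].

(* Main.v *)
Require Import Defs.
From mathcomp Require Import all_boot.
From mathcomp Require Import boolp classical_sets cardinality.

(** Let [(k, psi)] be an embedding of [A] into a finite EPPA-witness [B].  Since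
    there are no nullary functions, the empty set carries a substructure, so
    every [h] in the group is the language part of a partial automorphism with
    empty vertex part ([empty_partial_automorphism]); hence it is also the
    language part of some automorphism [t] of [B].  Taking [h] to be the
    conjugate of [g] by [k], the map [t \o psi] identifies the relabelled
    structure [g A] with a substructure of [B] through the language part
    [k g k^-1 k g^-1 = k], which does not depend on [g]
    ([relabel_pullback]).  A structure is determined by any embedding of it
    into [B] ([embedding_pullback]), so [g A] is determined by the vertex map
    [t] alone, and there are only finitely many maps from the vertex set of [B]
    to itself: the orbit of [A] is finite. *)

Set Implicit Arguments.
Unset Strict Implicit.
Unset Printing Implicit Defensive.

Local Open Scope classical_set_scope.

Section Pullback.
Context (L : language) (G : perm_group L).

Definition pullback (V W : countType) (B : structure L W) (g : lang_perm L)
    (f : V -> W) : structure L V :=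
  Structure
    (fun n (R : relsym L n) => [set x | srel B (prel g R) (map_tuple f x)])
    (fun n (F : funsym L n) x => f @^-1` sfun B (pfun g F) (map_tuple f x)).

Lemma structure_ext (V : countType) (A B : structure L V) :
  (forall n (R : relsym L n), srel A R = srel B R) ->
  (forall n (F : funsym L n) x, sfun A F x = sfun B F x) -> A = B.
Proof.
case: A B => [rA fA] [rB fB] /= eqr eqf; congr Structure.
  by apply: functional_extensionality_dep => n; apply/funext.
by apply: functional_extensionality_dep => n; apply/funext => F; apply/funext.
Qed.

(** Injectivity of the vertex map lets the value of a function of [A] be
    recovered from its image in [B]. *)
Lemma embedding_pullback (V W : countType) (A : structure L V)
    (B : structure L W) (g : lang_perm L) (f : V -> W) :
  embedding G A B g f -> A = pullback B g f.
Proof.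
case=> _ f_inj relE funE; apply: structure_ext => [n R|n F x] /=.
  by apply/seteqP; split=> x /relE.
rewrite -funE; apply/seteqP; split=> y; first by move=> Fy; exists y.
by case=> z Fz /f_inj <-.
Qed.

Lemma map_tuple_comp (U V W : Type) (f : V -> W) (g : U -> V) n
    (x : n.-tuple U) :
  map_tuple f (map_tuple g x) = map_tuple (f \o g) x.
Proof. by apply/val_inj; rewrite /= map_comp. Qed.

(** The language part of the automorphism is the conjugate of [g] by [k], so
    that it cancels the relabelling and leaves [k]. *)
Lemma relabel_pullback (V W : countType) (A : structure L V)
    (B : structure L W) (k g : lang_perm L) (psi : V -> W) (t : W -> W) :
  embedding G A B k psi ->
  embedding G B B (lpermM k (lpermM g (lpermV k))) t ->
  relabel g A = pullback B k (t \o psi).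
Proof.
move=> /embedding_pullback -> /embedding_pullback eqB.
apply: structure_ext => [n R|n F x] /=.
  apply/funext => x; rewrite /= {1}eqB /=.
  by rewrite prelK prelVK map_tuple_comp.
by rewrite {1}eqB /= pfunK pfunVK map_tuple_comp.
Qed.

End Pullback.

(** With neither nullary relations nor nullary functions there is no tuple of
    vertices to test, so every condition on the empty map is vacuous. *)
Lemma embedding_empty (L : language) (G : perm_group L) (V W : countType)
    (A : structure L V) (B : structure L W) (g : lang_perm L) (f : V -> W) :
  unary_functions L -> (V -> False) -> group_elt G g -> embedding G A B g f.
Proof.
move=> unaryL V0 Gg; split=> // [[|n] R x|n F x].
- by case: (rel_arity_gt0 R).
- by case: (V0 (thead x)).
- by have n1 := unaryL n F; subst n; case: (V0 (thead x)).
Qed.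

Lemma empty_partial_automorphism (L : language) (G : perm_group L)
    (V : countType) (A : structure L V) (g : lang_perm L) :
  unary_functions L -> group_elt G g ->
  partial_automorphism G A g (id : set_type (set0 : set V) -> set_type set0).
Proof.
move=> unaryL Gg.
have S0 : set_type (set0 : set V) -> False by case=> x; rewrite inE.
exists (induced A set0), (induced A set0); split.
- by apply: embedding_empty => //; exact: group_elt1.
- by apply: embedding_empty => //; exact: group_elt1.
- by split; [exact: embedding_empty | exists id].
Qed.

Theorem theorem1p3 (L : language) (G : perm_group L) (V : finType)
    (A : structure L V) :
  unary_functions L ->
  infinite_set (relabel_orbit G A) ->
  ~ (exists (W : finType) (B : structure L W), EPPA_witness G A B).
Proof.
move=> unaryL infA [W [B [k [psi [embA extB]]]]]; apply: infA.
have [Gk _ _ _] := embA.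
(* Finite functions, because the plain type W -> W is not a finite type. *)
pose Phi (t : {ffun W -> W}) := pullback B k (t \o psi).
apply: (@sub_finite_set _ _ (Phi @` setT)); last first.
  exact/finite_image/finite_finset.
move=> _ [g Gg <-].
have Gh : group_elt G (lpermM k (lpermM g (lpermV k))).
  by apply: group_eltM => //; apply: group_eltM => //; exact: group_eltV.
have [t [[autt _] _]] :=
  extB _ _ _ _ (empty_partial_automorphism (induced B (range psi)) unaryL Gh).
exists (finfun t) => //; rewrite (relabel_pullback embA autt) /Phi.
by congr pullback; apply/funext => x /=; rewrite ffunE.
Qed.
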